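(* Let $X$ be an infinite-dimensional Banach space. If $x\in S_X$ is a super AD point, then $\overline{\rho}_X(x,t)=t$ for every $t\in(0,1)$, hence $x$ is not asymptotically smooth (in particular, $x$ is not a point of Fréchet differentiability of the norm).
   Context: Banach spaces are over $\mathbb{K}$ ($\mathbb{R}$ or $\mathbb{C}$); $B_X$, $S_X$ denote the closed unit ball and the unit sphere of $X$; $\mathbb{T}=\{\theta\in\mathbb{K}:|\theta|=1\}$. A point $x\in S_X$ is a super AD point if $\sup_{y\in W}\max_{\theta\in\mathbb{T}}\|x+\theta y\|=2$ for every non-empty relatively weakly open subset $W$ of $B_X$ with $W\cap S_X\neq\emptyset$. Let $\mathrm{cof}(X)$ be the set of all (closed) subspaces of $X$ of finite codimension. The modulus of asymptotic smoothness at $x\in S_X$ is $\overline{\rho}_X(x,t):=\inf_{Y\in\mathrm{cof}(X)}\sup_{y\in S_Y}\{\|x+ty\|-1\}$, $t>0$. The point $x$ is asymptotically smooth if $\lim_{t\to0}\overline{\rho}_X(x,t)/t=0$. A point $x\in S_X$ is a point of Fréchet differentiability of the norm if there is $f\in S_{X^*}$ such that for every sequence $(f_n)$ in $S_{X^*}$, $f_n(x)\to 1$ if and only if $f_n\to f$ in norm. *)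

(* Defs.v *)
From HB Require Import structures.
From mathcomp Require Export all_boot all_order all_algebra.
From mathcomp Require Export complex.
From mathcomp Require Export all_classical all_reals all_analysis.
Export numFieldNormedType.Exports.
Import Order.TTheory GRing.Theory Num.Theory.

Set Implicit Arguments.
Unset Strict Implicit.
Unset Printing Implicit Defensive.

Local Open Scope classical_set_scope.
Local Open Scope ring_scope.

(* Everything is stated over a scalar field K : numFieldType, to be taken equal
   to R or R[i] with R : realType.  Norms are K-valued, and so are the suprema
   and infima below.  When K = R[i] the order of K is partial (z <= w iff
   z and w have the same imaginary part and Re z <= Re w): 0 < t says that t is
   a positive real number, and the least upper bound in K of a nonempty set of
   real numbers bounded above is its usual supremum. *)

Section Geometry.
Context {K : numFieldType} (X : normedModType K).
Implicit Types (x y : X) (Y W : set X) (t : K).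

Definition unit_ball : set X := [set x | `|x| <= 1].

Definition unit_sphere : set X := [set x | `|x| = 1].

Definition weak_topology :=
  @sup_topology X {f : {linear X -> K^o} | continuous f}
    (fun f => Topological.class (initial_topology (sval f : X -> K^o))).

Definition rel_weakly_open_in_ball W :=
  exists2 U : set weak_topology, open U & W = U `&` unit_ball.

(* T = [set theta | `|theta| = 1] is compact, so the maximum of
   `|x + theta *: y| over T exists and is the supremum. *)
Definition max_rotation_norm x y : K :=
  supremum 0 [set `|x + theta *: y| | theta in [set theta : K | `|theta| = 1]].

Definition super_AD_point x :=
  forall W, W !=set0 -> rel_weakly_open_in_ball W ->
    W `&` unit_sphere !=set0 ->
    supremum 0 [set max_rotation_norm x y | y in W] = 2.

Definition linear_subspace Y :=
  Y 0 /\ forall (a : K) x y, Y x -> Y y -> Y (a *: x + y).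

(* The quotient X / Y is spanned by the classes of finitely many vectors. *)
Definition finite_codimensional Y :=
  exists (n : nat) (e : 'I_n -> X),
    forall x, exists c : 'I_n -> K, Y (x - \sum_(i < n) c i *: e i).

Definition cof : set (set X) :=
  [set Y | [/\ linear_subspace Y, closed Y & finite_codimensional Y]].

Definition infinite_dimensional :=
  ~ exists (n : nat) (e : 'I_n -> X),
      forall x, exists c : 'I_n -> K, x = \sum_(i < n) c i *: e i.

Definition rho x t : K :=
  infimum 0 [set supremum 0 [set `|x + t *: y| - 1 | y in Y `&` unit_sphere]
            | Y in cof].

Definition asymptotically_smooth x := rho x t / t @[t --> 0^'+] --> (0 : K^o).

Definition dual_norm (f : X -> K) : K := supremum 0 [set `|f y| | y in unit_ball].

Definition dual_sphere : set {linear X -> K^o} :=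
  [set f | continuous f /\ dual_norm f = 1].

Definition Frechet_differentiability_point x :=
  exists2 f : {linear X -> K^o}, dual_sphere f &
    forall f_ : nat -> {linear X -> K^o}, (forall n, dual_sphere (f_ n)) ->
      (f_ n x @[n --> \oo] --> (1 : K^o)) <->
      (dual_norm (fun y => f_ n y - f y) @[n --> \oo] --> (0 : K^o)).

End Geometry.

(* Main.v *)
(* A closed subspace Y of finite codimension is the common kernel of finitely many
   continuous functionals.  The part of B_X where they are all small is weakly
   open, meets S_X because X is infinite-dimensional and so S_Y is nonempty, and
   lies within e of Y.  The super AD property gives y there and a unimodular theta
   with |x + theta y| > 2 - e; moving theta y to a nearby v in S_Y yields
   |x + t v| >= |x + v| - (1 - t) > 1 + t - O(e).
   If x were a Frechet point with derivative f, apply this to Y = ker f and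
   t_n -> 0: functionals g_n norming x + t_n y_n satisfy g_n(x) -> 1, while
   1 + t_n / 2 < |x + t_n y_n| <= 1 + t_n |(g_n - f)(y_n)| gives
   |g_n - f| >= 1/2.
   Real and complex scalars are treated at once: the Hahn-Banach theorem is first
   proved for K-valued functionals u that are linear over the real elements of K,
   and then y |-> u(y) - i u(i y) is K-linear, with i = 0 for real scalars. *)
From HB Require Import structures.
Require Import Defs.
From mathcomp Require Import ring.
Import Order.TTheory GRing.Theory Num.Theory.

Set Implicit Arguments.
Unset Strict Implicit.
Unset Printing Implicit Defensive.

Local Open Scope classical_set_scope.
Local Open Scope ring_scope.

(** * Completeness and imaginary unit for real and complex scalars *)

Definition real_complete (K : numFieldType) :=
  forall E : set K, E !=set0 -> (forall a, E a -> a \is Num.real) ->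
    has_ubound E -> supremums E !=set0.

(* For [i = 0] this says that K is real, and otherwise that K is obtained from
   its real part by adjoining a square root of -1. *)
Definition imaginary_unit (K : numFieldType) (i : K) :=
  [/\ i = 0 \/ i ^+ 2 = -1,
      forall a : K, exists b c,
        [/\ b \is Num.real, c \is Num.real & a = b + i * c]
    & forall b c, b \is Num.real -> c \is Num.real -> `|b| <= `|b + i * c|].

Lemma real_complete_realType (R : realType) : real_complete R.
Proof.
move=> E E0 _ ubE; have supE : has_sup E by [].
exists (sup E); split; first exact: sup_upper_bound.
by move=> b; exact: ge_sup.
Qed.

(** An upper bound in [R[i]] of a real number has zero imaginary part, so only real parts remain to
    be compared. *)
Lemma real_complete_complex (R : realType) : real_complete R[i].
Proof.
move=> E [a0 Ea0] Ereal [M ubM].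
pose F : set R := [set r | E (real_complex R r)].
have EF a : E a -> exists2 r, F r & a = real_complex R r.
  move=> Ea; have /complex_realP[r ar] := Ereal _ Ea.
  by exists r => //; rewrite /F /= -ar.
have supF : has_sup F.
  split; first by have [r Fr _] := EF _ Ea0; exists r.
  exists (complex.Re M) => r Fr; have := ubM _ Fr.
  by rewrite lecE => /andP[].
exists (real_complex R (sup F)); split.
  by move=> _ /EF[r Fr ->]; rewrite lecR; exact: sup_upper_bound.
move=> b ubb; rewrite lecE; apply/andP; split.
  have [r Fr a0r] := EF _ Ea0; have := ubb _ Ea0.
  by rewrite a0r lecE => /andP[].
apply: ge_sup; first exact: supF.1.
by move=> r Fr; have := ubb _ Fr; rewrite lecE => /andP[].
Qed.

Lemma imaginary_unit_realType (R : realType) : imaginary_unit (0 : R).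
Proof.
split; first by left.
- by move=> a; exists a, 0; split; rewrite ?num_real// mulr0 addr0.
- by move=> b c _ _; rewrite mul0r addr0.
Qed.

Lemma imaginary_unit_complex (R : realType) :
  imaginary_unit (Complex 0 1 : R[i]).
Proof.
split; first by right; exact: sqr_i.
- move=> a; exists (real_complex R (complex.Re a)).
  exists (real_complex R (complex.Im a)).
  by split; [apply/complex_realP; eexists..|exact: complexE].
- move=> _ _ /complex_realP[r ->] /complex_realP[s ->].
  have := normc_ge_Re (real_complex R r + Complex 0 1 * real_complex R s).
  rewrite [complex.Re _]/= mul0r mul1r subr0 addr0; apply: le_trans.
  by rewrite normc_def /= expr0n addr0 sqrtr_sqr.
Qed.

(** Otherwise [e^-1] bounds the positive integers, and their least upper bound [s] would satisfy
    [s <= s - 1]. *)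
Lemma real_complete_archimedean (K : numFieldType) : real_complete K ->
  forall e : K, 0 < e -> exists n, (n.+1%:R^-1 : K) < e.
Proof.
move=> Kc e e0; apply: contrapT => noN.
have [|x [n _ <-]||s [ubs lubs]] :=
    Kc [set n.+1%:R | n in [set: nat]] _ _ _.
- by exists 1; exists 0%N.
- by rewrite realn.
- exists e^-1 => _ [n _ <-].
  have : ~ (n.+1%:R^-1 : K) < e by move=> h; apply: noN; exists n.
  move/negP; rewrite -real_leNgt ?gtr0_real ?invr_gt0 ?ltr0Sn//.
  by rewrite -{2}[n.+1%:R]invrK lef_pV2 ?posrE ?invr_gt0 ?ltr0Sn.
have : s <= s - 1.
  apply: lubs => _ [n _ <-]; rewrite lerBrDr natr1.
  by apply: ubs; exists n.+1.
by rewrite lerBrDr gerDl ler10.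
Qed.

(** * Hahn-Banach for functionals linear over the real scalars *)

Section RealHahnBanach.
Variables (K : numFieldType) (X : lmodType K) (p : X -> K).
Hypothesis Kc : real_complete K.
Hypothesis p_real : forall x, p x \is Num.real.
Hypothesis p_subadd : forall x y, p (x + y) <= p x + p y.
Hypothesis p_homog : forall a x, 0 <= a -> p (a *: x) = a * p x.

(** Partial functionals are encoded as graphs, to be ordered by inclusion. Single-valuedness is a
    consequence: two values over one point differ by a real number that is at most [p 0 = 0], in
    either order. *)
Definition dominated_graph (A : set (X * K)) :=
  (forall a q r, a \is Num.real -> A q -> A r ->
    A (a *: q.1 + r.1, a * q.2 + r.2)) /\
  (forall q, A q -> q.2 \is Num.real /\ q.2 <= p q.1).

(** Domination confines the value [c] at [x0] between the numbers [q.2 - p (q.1 - x0)] and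
    [p (r.1 + x0) - r.2]. Subadditivity puts the former below the latter, so the supremum of the
    former will do. *)
Lemma dominated_graph_extend A x0 : dominated_graph A -> A (0, 0) ->
  exists c, dominated_graph
    [set (q.1 + a *: x0, q.2 + a * c) | q in A & a in [set a | a \is Num.real]].
Proof.
move=> [Alin Adom] A0.
have Asub q r : A q -> A r -> q.2 - p (q.1 - x0) <= p (r.1 + x0) - r.2.
  move=> Aq Ar; rewrite lerBlDr -addrAC lerBrDr addrC.
  have -> : q.2 + r.2 = (1 *: q.1 + r.1, 1 * q.2 + r.2).2 by rewrite /= mul1r.
  apply: (le_trans (Adom _ (Alin 1 _ _ (rpred1 _) Aq Ar)).2) => /=.
  rewrite scale1r; have -> : q.1 + r.1 = (q.1 - x0) + (r.1 + x0).
    by rewrite addrACA addNr addr0.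
  exact: p_subadd.
have [|a [q Aq <-]||c [ubc lubc]] :=
    @Kc [set q.2 - p (q.1 - x0) | q in A] _ _ _.
- by exists (0 - p (0 - x0)); exists (0, 0).
- by rewrite realB// (Adom _ Aq).1.
- by exists (p (0 + x0) - 0) => _ [q Aq <-]; exact: (Asub q _ Aq A0).
(* The order may be partial, so realness comes from lying above a real number. *)
have c_real : c \is Num.real.
  have h : 0 - p (0 - x0) <= c by apply: ubc; exists (0, 0).
  rewrite -[c](subrK (0 - p (0 - x0))) realD//.
    by rewrite ger0_real// subr_ge0.
  by rewrite realB//= real0.
have Ascale b q : b \is Num.real -> A q -> A (b *: q.1, b * q.2).
  by move=> br Aq; have := Alin b _ _ br Aq A0; rewrite /= !addr0.
exists c; split.
- move=> a _ _ ar [q Aq [b br <-]] [r Ar [d dr <-]] /=.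
  exists (a *: q.1 + r.1, a * q.2 + r.2); first exact: Alin.
  exists (a * b + d); first by rewrite /= realD// realM.
  congr pair => /=; last by ring.
  by rewrite scalerDl scalerDr scalerA addrACA.
- move=> _ [q Aq [a ar <-]] /=; split.
    by rewrite realD// ?realM// (Adom _ Aq).1.
  (* Dividing by [a > 0] leads to the upper constraint on [c], dividing by [- a > 0] to the lower
     one. *)
  have [a0|a0|->] := real_ltgt0P ar.
  + have an0 : a != 0 by rewrite gt_eqF.
    have air : a^-1 \is Num.real by rewrite realV.
    have -> : q.1 + a *: x0 = a *: (a^-1 *: q.1 + x0).
      by rewrite scalerDr scalerA divff// scale1r.
    rewrite (p_homog _ (ltW a0)).
    have -> : q.2 + a * c = a * (a^-1 * q.2 + c).
      by rewrite mulrDr mulrA divff// mul1r.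
    rewrite ler_pM2l// addrC -lerBrDr.
    apply: lubc => _ [r Ar <-].
    exact: (Asub r _ Ar (Ascale _ _ air Aq)).
  + pose b := - a; have b0 : 0 < b by rewrite oppr_gt0.
    have bn0 : b != 0 by rewrite gt_eqF.
    have bir : b^-1 \is Num.real by rewrite realV realN.
    have -> : q.1 + a *: x0 = b *: (b^-1 *: q.1 - x0).
      by rewrite scalerBr scalerA divff// scale1r scaleNr opprK.
    rewrite (p_homog _ (ltW b0)).
    have -> : q.2 + a * c = b * (b^-1 * q.2 - c).
      by rewrite mulrBr mulrA divff// mul1r mulNr opprK.
    rewrite ler_pM2l// lerBlDr -lerBlDl.
    by apply: ubc; exists (b^-1 *: q.1, b^-1 * q.2) => //; exact: Ascale.
  + by rewrite scale0r mul0r !addr0; exact: (Adom _ Aq).2.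
Qed.

Lemma real_Hahn_Banach z : exists u : X -> K,
  [/\ forall a x y, a \is Num.real -> u (a *: x + y) = a * u x + u y,
      forall x, u x \is Num.real, forall x, u x <= p x & u z = p z].
Proof.
pose L0 := [set (a *: z, a * p z) | a in [set a : K | a \is Num.real]].
have p0 : p 0 = 0 by rewrite -(scale0r z) p_homog// mul0r.
have domL0 : dominated_graph L0.
  split.
    move=> a _ _ ar [b br <-] [c cr <-] /=.
    exists (a * b + c); first by rewrite /= realD// realM.
    by congr pair; rewrite ?scalerDl ?scalerA// mulrDl mulrA.
  move=> _ [a ar <-] /=; split; first by rewrite realM.
  have [a0|a0|->] := real_ltgt0P ar; last by rewrite mul0r scale0r p0.
    by rewrite (p_homog _ (ltW a0)).
  have := p_subadd (a *: z) (- a *: z).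
  have a0' : 0 <= - a by rewrite oppr_ge0 ltW.
  by rewrite -scalerDl subrr scale0r p0 (p_homog _ a0') mulNr subr_ge0.
have [|A [[domA AL0] maxA]] :=
    @Zorn_bigcup _ [set A | dominated_graph A /\ (A !=set0 -> L0 `<=` A)].
  move=> F FP Ftot; split; last first.
    move=> [q [A FA Aq]] r Lr; exists A => //.
    by apply: (FP _ FA).2 => //; exists q.
  split; last by move=> q [A FA Aq]; exact: ((FP _ FA).1.2 q Aq).
  move=> a q r ar [A FA Aq] [B FB Br].
  have [AB|BA] := Ftot _ _ FA FB.
    by exists B => //; apply: (FP _ FB).1.1 => //; exact: AB.
  by exists A => //; apply: (FP _ FA).1.1 => //; exact: BA.
have {}AL0 : L0 `<=` A.
  have [A0|/set0P An0] := eqVneq A set0; last exact: AL0.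
  rewrite A0 => q L0q; exfalso.
  have AL : A `<` L0 by rewrite A0; split; [exact: sub0set|move=> /(_ _ L0q)].
  by apply: (maxA _ AL); split => //= _; exact: subset_refl.
have A0 : A (0, 0).
  by apply: AL0; exists 0; rewrite /= ?real0// scale0r mul0r.
have domain x : exists r, A (x, r).
  apply: contrapT => nAx.
  have [c domB] := dominated_graph_extend x domA A0.
  set B := (X in dominated_graph X) in domB.
  have AB : A `<=` B.
    move=> [y r] Ayr; exists (y, r) => //; exists 0; rewrite /= ?real0//.
    by rewrite scale0r mul0r !addr0.
  apply: (maxA B); last first.
    by split=> //= _; exact: subset_trans AL0 AB.
  split=> // BA; apply: nAx; exists c; apply: BA.
  by exists (0, 0) => //; exists 1; rewrite /= ?real1// scale1r mul1r !add0r.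
have [u Au] := choice domain.
have [Alin Adom] := domA.
have uniq x r : A (x, r) -> r = u x.
  move=> Axr; apply/eqP; rewrite eq_le; apply/andP; split; rewrite -subr_le0.
    have := Adom _ (Alin (-1) _ _ (rpredN1 _) (Au x) Axr).
    by rewrite /= scaleN1r addNr p0 mulN1r addrC => -[].
  have := Adom _ (Alin (-1) _ _ (rpredN1 _) Axr (Au x)).
  by rewrite /= scaleN1r addNr p0 mulN1r addrC => -[].
exists u; split.
- by move=> a x y ar; rewrite -(uniq _ _ (Alin a _ _ ar (Au x) (Au y))).
- by move=> x; exact: (Adom _ (Au x)).1.
- by move=> x; exact: (Adom _ (Au x)).2.
- by apply/esym/uniq/AL0; exists 1; rewrite /= ?real1// scale1r mul1r.
Qed.

End RealHahnBanach.

(** * Hahn-Banach over [K], separation from closed subspaces, and reduction modulo a subspace of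
    finite codimension *)

Section HahnBanach.
Variables (K : numFieldType) (i : K).
Hypotheses (Kc : real_complete K) (Ki : imaginary_unit i).

Lemma seminorm_ge0 (X : lmodType K) (p : X -> K) :
  (forall x y, p (x + y) <= p x + p y) ->
  (forall a x, p (a *: x) = `|a| * p x) -> forall x, 0 <= p x.
Proof.
move=> pD pZ x; have p00 : p 0 = 0 by rewrite -(scale0r 0) pZ normr0 mul0r.
have := pD x (- x).
by rewrite subrr p00 -scaleN1r pZ normrN1 mul1r -mulr2n pmulrn_lge0.
Qed.

Lemma seminorm_Hahn_Banach (X : lmodType K) (p : X -> K) (z : X) :
  (forall x y, p (x + y) <= p x + p y) ->
  (forall a x, p (a *: x) = `|a| * p x) ->
  exists f : {linear X -> K^o}, (forall x, `|f x| <= p x) /\ f z = p z.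
Proof.
move=> pD pZ; have p0 := seminorm_ge0 pD pZ.
have [i2 Kdec Kre] := Ki.
have [||a x a0|u [ulin ureal up uz]] := @real_Hahn_Banach K X p Kc _ _ _ z.
- by move=> x; exact: ger0_real.
- exact: pD.
- by rewrite pZ ger0_norm.
pose g x : K := u x - i * u (i *: x).
have uD x y : u (x + y) = u x + u y.
  by rewrite -[x in LHS]scale1r ulin ?real1// mul1r.
have u0 : u 0 = 0 by apply: (@addrI _ (u 0)); rewrite -uD !addr0.
have uZ a x : a \is Num.real -> u (a *: x) = a * u x.
  by move=> ar; rewrite -[a *: x]addr0 ulin// u0 addr0.
have gi x : g (i *: x) = i * g x.
  rewrite /g scalerA; case: i2 => [->|i2].
    by rewrite !mul0r !scale0r u0 subr0.
  rewrite -expr2 i2 (uZ (-1)) ?realN ?real1// mulrBr (mulrA i i) -expr2 i2.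
  by ring.
have gD x y : g (x + y) = g x + g y by rewrite /g scalerDr !uD; ring.
have gZr a x : a \is Num.real -> g (a *: x) = a * g x.
  move=> ar; have -> : g (a *: x) = u (a *: x) - i * u (a *: (i *: x)).
    by rewrite /g !scalerA (mulrC i a).
  by rewrite !(uZ a)// mulrBr mulrCA.
have gZ a x : g (a *: x) = a * g x.
  have [b [c [br cr ->]]] := Kdec a.
  by rewrite scalerDl -scalerA gD gi !gZr//; ring.
have gp x : `|g x| <= p x.
  have [->|gx0] := eqVneq (g x) 0; first by rewrite normr0 p0.
  pose t := `|g x| / g x.
  have t1 : `|t| = 1 by rewrite normf_div normr_id divff// normr_eq0.
  have gt : g (t *: x) = `|g x| by rewrite gZ divfK.
  (* This difference is real and equals [- i] times a real number, so when [i ^+ 2 = -1] its square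
     is both nonnegative and nonpositive. *)
  suff : `|g x| - u (t *: x) = 0.
    move/eqP; rewrite subr_eq0 => /eqP ->.
    by rewrite (le_trans (up _))// pZ t1 mul1r.
  have h : `|g x| - u (t *: x) = - (i * u (i *: (t *: x))).
    by rewrite -gt /g addrAC subrr add0r.
  case: i2 => [i0|i2]; first by rewrite h i0 mul0r oppr0.
  apply/eqP; rewrite -sqrf_eq0 eq_le; apply/andP; split.
    by rewrite h sqrrN exprMn i2 mulN1r oppr_le0 real_exprn_even_ge0.
  by rewrite real_exprn_even_ge0// realB.
have pg : `|g z| = p z.
  apply/eqP; rewrite eq_le gp/= -uz -[u z]ger0_norm ?uz ?p0// -uz.
  by rewrite /g -mulrN Kre// realN.
(* Only the modulus of [g z] has been computed; a unimodular factor turns it into the value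
   itself. *)
have [t [t1 tg]] : exists t, `|t| = 1 /\ t * g z = p z.
  have [gz0|gz0] := eqVneq (g z) 0.
    by exists 1; rewrite normr1 -pg gz0 normr0 mulr0.
  exists (`|g z| / g z); rewrite normf_div normr_id divff ?normr_eq0//.
  by rewrite divfK.
have flin : linear ((fun x => t * g x) : X -> K^o).
  by move=> a x y; rewrite gD gZ /GRing.scale/=; ring.
pose flM := GRing.isLinear.Build K X K^o *:%R (fun x => t * g x) flin.
pose f : {linear X -> K^o} := HB.pack (fun x => t * g x) flM.
exists f; split => //= x.
by rewrite normrM t1 mul1r.
Qed.

(** [d] is the distance to [Y], that is, the quotient seminorm, obtained as minus the supremum of
    the numbers [- |x - y|]. *)
Lemma subspace_distance (X : normedModType K) (Y : set X) :
  linear_subspace Y -> exists d : X -> K,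
  [/\ forall x y, d (x + y) <= d x + d y,
      forall a x, d (a *: x) = `|a| * d x,
      forall x y, Y y -> d x <= `|x - y|
    & forall x r, (forall y, Y y -> r <= `|x - y|) -> r <= d x].
Proof.
move=> [Y0 Ylin].
have Dex x : exists r, (forall y, Y y -> r <= `|x - y|) /\
    (forall s, (forall y, Y y -> s <= `|x - y|) -> s <= r).
  have [|a [y Yy <-]||r [ubr lubr]] := @Kc [set - `|x - y| | y in Y] _ _ _.
  - by exists (- `|x - 0|); exists 0.
  - by rewrite realN normr_real.
  - by exists 0 => _ [y Yy <-]; rewrite oppr_le0.
  exists (- r); split=> [y Yy|s sle].
    by rewrite lerNl; apply: ubr; exists y.
  by rewrite lerNr; apply: lubr => _ [y Yy <-]; rewrite lerN2 sle.
have [d dP] := choice Dex.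
have dle x : forall y, Y y -> d x <= `|x - y| := (dP x).1.
have dge x : forall r, (forall y, Y y -> r <= `|x - y|) -> r <= d x := (dP x).2.
(* The reverse inequality is the instance of this one at [a^-1] and [a *: x]. *)
have dZle a x : a != 0 -> `|a| * d x <= d (a *: x).
  move=> a0; apply: dge => y Yy.
  have -> : a *: x - y = a *: (x - a^-1 *: y).
    by rewrite scalerBr scalerA divff// scale1r.
  rewrite normrZ ler_pM2l ?normr_gt0//; apply: dle.
  by rewrite -[_ *: _]addr0; exact: Ylin.
exists d; split => //.
- move=> x x'; rewrite -lerBlDr; apply: (dge x) => y Yy.
  rewrite lerBlDr -lerBlDl; apply: (dge x') => y' Yy'.
  rewrite lerBlDl; apply: le_trans (ler_normD _ _).
  rewrite addrACA -opprD; apply: dle.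
  by rewrite -[y]scale1r; exact: Ylin.
- move=> a x; have [->|a0] := eqVneq a 0.
    rewrite scale0r normr0 mul0r; apply/eqP; rewrite eq_le dge//= andbT.
    by apply: le_trans (dle _ _ Y0) _; rewrite subr0 normr0.
  apply/eqP; rewrite eq_le dZle// andbT.
  rewrite -ler_pdivrMl ?normr_gt0// -normfV.
  have := @dZle a^-1 (a *: x).
  by rewrite invr_eq0 scalerA mulVf// scale1r; apply.
Qed.

Lemma bounded_functional_continuous (X : normedModType K)
    (f : {linear X -> K^o}) :
  (forall x, `|f x| <= `|x|) -> continuous f.
Proof.
move=> fle x; apply/cvgrPdist_lt => e e0; near=> y.
rewrite -linearB; apply: le_lt_trans (fle _) _.
by near: y; exact: cvgr_dist_lt.
Unshelve. all: by end_near. Qed.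

(** Hahn-Banach is applied to the distance [d] to [Y], which vanishes on [Y], is at most the norm,
    and is positive at [e] because [Y] is closed. The functional is then divided by [d e]. *)
Lemma separating_functional (X : normedModType K) (Y : set X) (e : X) :
  linear_subspace Y -> closed Y -> ~ Y e ->
  exists f : {linear X -> K^o},
    [/\ continuous f, forall y, Y y -> f y = 0 & f e = 1].
Proof.
move=> Ylin Ycl Ye; have [d [dD dZ dle dge]] := subspace_distance Ylin.
have d0 := seminorm_ge0 dD dZ.
have de : d e != 0.
  apply/eqP => de0; apply: Ye; apply: Ycl => B /nbhs_normP[r /= r0 rB].
  apply: contrapT => YB.
  suff : r <= d e by rewrite de0 lt_geF.
  apply: dge => y Yy; rewrite real_leNgt ?(gtr0_real r0) ?normr_real//.
  by apply/negP => ey; apply: YB; exists y; split=> //; exact: rB.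
have [f [fd fe]] := seminorm_Hahn_Banach e dD dZ.
have flin : linear ((fun x => (d e)^-1 * f x) : X -> K^o).
  by move=> a x y; rewrite linearP /GRing.scale/=; ring.
pose gM := GRing.isLinear.Build K X K^o *:%R (fun x => (d e)^-1 * f x) flin.
pose g : {linear X -> K^o} := HB.pack (fun x => (d e)^-1 * f x) gM.
have fc : continuous f.
  apply: bounded_functional_continuous => x; apply: le_trans (fd x) _.
  by apply: le_trans (dle _ _ Ylin.1) _; rewrite subr0.
exists g; split=> /=.
- by move=> x; apply: cvgM; [exact: cvg_cst|exact: fc].
- move=> y Yy; suff -> : f y = 0 by rewrite mulr0.
  apply/eqP; rewrite -normr_le0; apply: le_trans (fd y) _.
  by apply: le_trans (dle _ _ Yy) _; rewrite subrr normr0.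
- by rewrite fe mulVf.
Qed.

(** Induction on the number of spanning vectors. A first vector in [Y] is dropped. Otherwise [f0]
    kills [Y] with value 1 at that vector, the other vectors are projected into the kernel of [f0],
    and the functionals given by induction are composed with this projection. *)
Lemma finite_codimensional_projection (X : normedModType K) (Y : set X) n
    (e : 'I_n -> X) : linear_subspace Y -> closed Y ->
  exists m (f : 'I_m -> {linear X -> K^o}) (v : 'I_m -> X),
  [/\ forall j, continuous (f j), forall j y, Y y -> f j y = 0
    & forall z, (exists c : 'I_n -> K, Y (z - \sum_(k < n) c k *: e k)) ->
        Y (z - \sum_(j < m) f j z *: v j)].
Proof.
move=> Ylin Ycl; elim: n e => [|n IH] e.
  exists 0%N, (fun=> \0 : {linear X -> K^o}), (fun=> 0); split=> [[]||z [c]] //.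
  by rewrite !big_ord0.
have [Ye|Ye] := pselect (Y (e ord0)).
  have [m [f [v [fc fY fP]]]] := IH (fun k => e (lift ord0 k)).
  exists m, f, v; split=> // z [c cP]; apply: fP.
  exists (fun k => c (lift ord0 k)).
  rewrite big_ord_recl/= in cP.
  have := Ylin.2 (c ord0) _ _ Ye cP.
  by rewrite opprD addrCA addNKr.
have [f0 [f0c f0Y f0e]] := separating_functional Ylin Ycl Ye.
have [m [f [v [fc fY fP]]]] :=
  IH (fun k => e (lift ord0 k) - f0 (e (lift ord0 k)) *: e ord0).
have hlin j : linear ((fun z => f j z - f0 z * f j (e ord0)) : X -> K^o).
  by move=> a x y; rewrite !linearP /GRing.scale/=; ring.
pose hM j := GRing.isLinear.Build K X K^o *:%R
  (fun z => f j z - f0 z * f j (e ord0)) (hlin j).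
pose h j : {linear X -> K^o} :=
  HB.pack (fun z => f j z - f0 z * f j (e ord0)) (hM j).
exists m.+1, (fun j => oapp h f0 (unlift ord0 j)),
  (fun j => oapp v (e ord0) (unlift ord0 j)); split.
- move=> j; case: unliftP => [k _|_] //=.
  move=> x; apply: cvgB; first exact: fc.
  by apply: cvgM; [exact: f0c|exact: cvg_cst].
- move=> j y Yy; case: unliftP => [k _|_] /=; last exact: f0Y.
  by rewrite fY// f0Y// mul0r subr0.
- move=> z [c cP]; rewrite big_ord_recl unlift_none /=.
  under eq_bigr do rewrite liftK /=.
  pose z' := z - f0 z *: e ord0.
  have hz k : f k z - f0 z * f k (e ord0) = f k z'.
    by rewrite /z' linearB [f k (_ *: _)]linearZ.
  under eq_bigr do rewrite hz.
  rewrite opprD addrA; apply: fP; exists (fun k => c (lift ord0 k)).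
  suff -> : z' - \sum_(k < n) c (lift ord0 k) *:
      (e (lift ord0 k) - f0 (e (lift ord0 k)) *: e ord0) =
      z - \sum_(k < n.+1) c k *: e k by [].
  (* Obtained by applying [f0] to the element of [Y] in [cP]. *)
  have f0z : f0 z = c ord0 +
      \sum_(k < n) c (lift ord0 k) * f0 (e (lift ord0 k)).
    have /eqP := f0Y _ cP; rewrite linearB subr_eq0 => /eqP ->.
    rewrite linear_sum big_ord_recl [f0 (_ *: _)]linearZ f0e.
    congr (_ + _); first exact: mulr1.
    by apply: eq_bigr => k _; rewrite linearZ.
  have -> : \sum_(k < n) c (lift ord0 k) *:
      (e (lift ord0 k) - f0 (e (lift ord0 k)) *: e ord0) =
      \sum_(k < n) c (lift ord0 k) *: e (lift ord0 k) -
      (\sum_(k < n) c (lift ord0 k) * f0 (e (lift ord0 k))) *: e ord0.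
    rewrite scaler_suml -sumrB; apply: eq_bigr => k _.
    by rewrite scalerBr scalerA.
  rewrite big_ord_recl /z' f0z scalerDl !opprD !opprK.
  by rewrite -!addrA; do 2 congr (_ + _); rewrite addrCA addNr addr0.
Qed.

End HahnBanach.

(** * Suprema with default value 0 *)

Lemma supremum_supremums (K : numFieldType) (E : set K) (a s : K) :
  E a -> supremums E s -> supremum 0 E = s.
Proof.
move=> Ea sE; rewrite /supremum; case: (eqVneq E set0) => [E0|_].
  by rewrite E0 in Ea.
by case: xgetP => [_ -> rE|/(_ s)//]; exact: is_subset1_supremums rE sE.
Qed.

(** The value 0 is returned when no least upper bound exists, so a nonzero value certifies
    existence. *)
Lemma supremum_neq0 (K : numFieldType) (E : set K) :
  supremum 0 E != 0 -> supremums E (supremum 0 E).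
Proof.
rewrite /supremum; case: (eqVneq E set0) => _; first by rewrite eqxx.
by case: xgetP => [_ -> //|_]; rewrite eqxx.
Qed.

Lemma supremum_ge0 (K : numFieldType) (E : set K) :
  (forall a, E a -> 0 <= a) -> 0 <= supremum 0 E.
Proof.
move=> E0; have [->//|s0] := eqVneq (supremum 0 E) 0.
have [ubE _] := supremum_neq0 s0.
have [E00|/set0P[a Ea]] := eqVneq E set0.
  by rewrite E00 supremum0 in s0 *.
exact: le_trans (E0 _ Ea) (ubE _ Ea).
Qed.

Lemma lt_supremum (K : numFieldType) (E : set K) (r : K) :
  (forall a, E a -> 0 <= a) -> 0 <= r -> r < supremum 0 E ->
  exists2 a, E a & r < a.
Proof.
move=> E0 r0 rs; have [_ lubE] := supremum_neq0 (lt0r_neq0 (le_lt_trans r0 rs)).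
apply: contrapT => nE; have : supremum 0 E <= r.
  apply: lubE => a Ea; rewrite real_leNgt ?ger0_real//; last exact: E0.
  by apply/negP => ra; apply: nE; exists a.
by rewrite lt_geF.
Qed.

(** * Weakly open sets and subspaces of finite codimension *)

Lemma weakly_open_slice (K : numFieldType) (X : normedModType K) m
    (f : 'I_m -> {linear X -> K^o}) (d : K) :
  (forall j, continuous (f j)) -> 0 < d ->
  open ([set y | forall j, `|f j y| < d] : set (weak_topology X)).
Proof.
move=> fc d0; rewrite openE => y Uy.
apply: (@filter_forall (weak_topology X) 'I_m
  (fun j => [set z | `|f j z| < d]) (nbhs (y : weak_topology X))) => j.
have yy : nbhs (y : weak_topology X) --> (y : weak_topology X) by [].
(* Convergence in the supremum topology is convergence in each initial topology, which makes [f j]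
   weakly continuous at [y]. *)
have := (@cvg_sup X {g : {linear X -> K^o} | continuous g}
  (fun g => Topological.class (initial_topology (sval g : X -> K^o)))
  (nbhs (y : weak_topology X)) y (nbhs_filter (y : weak_topology X))).1 yy.
move=> /(_ (exist _ (f j) (fc j))) fyy.
apply: (fyy [set z | `|f j z| < d]).
apply: (@initial_continuous X K^o (f j) y [set a : K^o | `|a| < d]).
apply/nbhs_normP; exists (d - `|f j y|) => [|a /= ya].
  by rewrite /= subr_gt0.
rewrite -[a](subKr (f j y)); apply: le_lt_trans (ler_normB _ _) _.
by rewrite addrC -ltrBrDr.
Qed.

Lemma cofT (K : numFieldType) (X : normedModType K) : cof [set: X].
Proof.
split; [by [] | exact: closedT |].
by exists 0%N, (fun=> 0) => x; exists (fun=> 0).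
Qed.

(** If [Y] were zero, the vectors spanning the quotient would span [X]. *)
Lemma cof_unit_vector (K : numFieldType) (X : normedModType K) (Y : set X) :
  infinite_dimensional X -> cof Y -> exists2 y, Y y & `|y| = 1.
Proof.
move=> Xinf [[Y0 Ylin] _ [n [e eP]]].
have [u [Yu u0]] : exists u, Y u /\ u != 0.
  apply: contrapT => nu; apply: Xinf; exists n, e => x.
  have [c Yc] := eP x; exists c; apply/eqP; rewrite -subr_eq0.
  by apply/negPn/negP => xc; apply: nu; exists (x - \sum_(k < n) c k *: e k).
exists (`|u|^-1 *: u); first by rewrite -[_ *: _]addr0; exact: Ylin.
by rewrite normrZ normfV normr_id mulVf// normr_eq0.
Qed.

(** * The modulus of asymptotic smoothness at a super AD point *)

Section Modulus.
Variables (K : numFieldType) (i : K).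
Hypotheses (Kc : real_complete K) (Ki : imaginary_unit i).
Variables (X : normedModType K) (x : X).
Hypotheses (Xinf : infinite_dimensional X) (x1 : unit_sphere x).
Hypothesis xAD : super_AD_point x.

Lemma cof_weak_neighborhood (Y : set X) (e : K) : cof Y -> 0 < e ->
  exists U : set (weak_topology X), [/\ open U, Y `<=` U &
    forall y, U y -> exists2 y', Y y' & `|y - y'| <= e].
Proof.
move=> [Ylin Ycl [n [b bP]]] e0.
have [m [f [v [fc fY fP]]]] :=
  finite_codimensional_projection Kc Ki b Ylin Ycl.
pose D := \sum_(j < m) `|v j|.
have D0 : 0 <= D by apply: sumr_ge0.
have D1 : 0 < D + 1 by rewrite ltr_wpDl.
have d0 : 0 < e / (D + 1) by rewrite divr_gt0.
(* The correction [\sum_j f j y *: v j] has norm at most [e / (D + 1) * D <= e]; adding 1 covers the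
   case [D = 0]. *)
exists [set y | forall j, `|f j y| < e / (D + 1)]; split.
- exact: weakly_open_slice.
- by move=> y Yy j; rewrite fY// normr0.
- move=> y Uy; exists (y - \sum_(j < m) f j y *: v j); first exact: fP.
  rewrite opprB addrC subrK; apply: le_trans (ler_norm_sum _ _ _) _.
  apply: (@le_trans _ _ (e / (D + 1) * D)).
    rewrite mulr_sumr; apply: ler_sum => j _.
    by rewrite normrZ ler_wpM2r// ltW// Uy.
  rewrite mulrAC ler_pdivrMr// ler_pM2l//.
  by rewrite lerDl ler01.
Qed.

(** One [e] is lost in approaching the supremum 2, one in moving [y] to [y'] in [Y], and two in
    normalizing [y'], whose norm is within [e + e] of 1. The rotation is absorbed in [v], and
    [e + e <= 1] keeps [y'] nonzero. *)
Lemma super_AD_cof (Y : set X) (e : K) : cof Y -> 0 < e -> e + e <= 1 ->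
  exists2 v, Y v /\ `|v| = 1 & 2 - e - e - e - e < `|x + v|.
Proof.
move=> Yc e0 e1; have [U [Uopen YU UY]] := cof_weak_neighborhood Yc e0.
pose W : set X := U `&` @unit_ball K X.
have [y0 Yy0 y01] := cof_unit_vector Xinf Yc.
have Wy0 : W y0 by split; [exact: YU|rewrite /unit_ball/= y01].
have Wsup : supremum 0 [set max_rotation_norm x y | y in W] = 2.
  apply: xAD; first by exists y0.
  - by exists U.
  - by exists y0.
have e2 : 0 <= 2 - e.
  have e_le1 : e <= 1 by rewrite (le_trans _ e1)// lerDl ltW.
  by rewrite subr_ge0 (le_trans e_le1)// ler1n.
have [_ [y [Uy y1] <-] ye] : exists2 a,
    [set max_rotation_norm x y | y in W] a & 2 - e < a.
  apply: lt_supremum => //; last by rewrite Wsup gtrBl.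
  by move=> _ [y _ <-]; apply: supremum_ge0 => _ [t _ <-].
have [_ [t t1 <-] te] : exists2 a,
    [set `|x + t *: y| | t in [set t : K | `|t| = 1]] a & 2 - e < a.
  by apply: lt_supremum => // _ [t _ <-].
have [y' Yy' yy'] := UY _ Uy.
have xy' : 2 - e - e < `|x + t *: y'|.
  rewrite ltrBlDr; apply: lt_le_trans te _.
  have -> : x + t *: y = (x + t *: y') + t *: (y - y').
    by rewrite scalerBr -addrA [_ *: y' + _]addrC subrK.
  by apply: le_trans (ler_normD _ _) _; rewrite lerD2l normrZ t1 mul1r.
have y'lt : 1 - e - e < `|y'|.
  have -> : 1 - e - e = 2 - e - e - 1 by ring.
  rewrite ltrBlDl; apply: lt_le_trans xy' _.
  by apply: le_trans (ler_normD _ _) _; rewrite x1 normrZ t1 mul1r.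
have y'0 : 0 < `|y'|.
  by apply: le_lt_trans y'lt; rewrite -addrA -opprD subr_ge0.
have y'le : `|y'| <= 1 + (e + e).
  rewrite -[y'](subKr y); apply: le_trans (ler_normB _ _) _.
  by apply: lerD => //; rewrite (le_trans yy')// lerDl ltW.
exists (t *: (`|y'|^-1 *: y')).
  case: Yc => [[Y0 Ylin] _ _]; split.
    rewrite scalerA -[_ *: _]addr0; exact: Ylin.
  by rewrite !normrZ t1 mul1r normfV normr_id mulVf// gt_eqF.
have -> : 2 - e - e - e - e = 2 - e - e - (e + e) by ring.
rewrite ltrBlDr; apply: lt_le_trans xy' _.
have -> : x + t *: y' =
    x + t *: (`|y'|^-1 *: y') + t *: ((1 - `|y'|^-1) *: y').
  by rewrite -addrA -scalerDr -scalerDl addrCA subrr addr0 scale1r.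
apply: le_trans (ler_normD _ _) _; rewrite lerD2l normrZ t1 mul1r normrZ.
rewrite -[in X in _ * X]normr_id -normrM mulrBl mul1r mulVf ?gt_eqF//.
rewrite real_ler_distl ?normr_real// y'le andbT.
by rewrite opprD addrA ltW.
Qed.

Lemma super_AD_modulus (Y : set X) (t e : K) : cof Y -> 0 < t < 1 -> 0 < e ->
  exists2 y, Y y /\ `|y| = 1 & 1 + t - e < `|x + t *: y|.
Proof.
move=> Yc /andP[t0 t1] e0.
(* Chosen so that [4 d = e / (1 + e)] is at most both [e] and 1. *)
pose d := e / (4 * (1 + e)).
have e1 : 0 < 1 + e by rewrite ltr_wpDl// ltr01.
have d0 : 0 < d by rewrite divr_gt0// mulr_gt0.
have d4 : d + d + d + d = e / (1 + e).
  by rewrite /d; field; rewrite gt_eqF.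
have d4e : d + d + d + d <= e.
  by rewrite d4 ler_pdivrMr// (ler_peMr (ltW e0))// lerDl ltW.
have d41 : d + d + d + d <= 1.
  by rewrite d4 ler_pdivrMr// mul1r lerDr.
have d21 : d + d <= 1.
  by apply: le_trans d41; rewrite -addrA lerDl addr_ge0// ltW.
have [v [Yv v1] xv] := super_AD_cof Yc d0 d21.
exists v => //.
have xtv : `|x + v| <= `|x + t *: v| + (1 - t).
  have -> : x + v = x + t *: v + (1 - t) *: v.
    by rewrite -addrA -scalerDl subrKC scale1r.
  apply: le_trans (ler_normD _ _) _.
  by rewrite normrZ v1 mulr1 ger0_norm// subr_ge0 ltW.
apply: (@le_lt_trans _ _ (2 - d - d - d - d - (1 - t))).
  have -> : 2 - d - d - d - d - (1 - t) = 1 + t - (d + d + d + d) by ring.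
  by rewrite lerD2l lerN2.
by rewrite ltrBlDr; exact: lt_le_trans xv xtv.
Qed.

Lemma super_AD_supremum (Y : set X) (t : K) : cof Y -> 0 < t < 1 ->
  supremum 0 [set `|x + t *: y| - 1 | y in Y `&` @unit_sphere K X] = t.
Proof.
move=> Yc t01; have /andP[t0 t1] := t01.
have [y0 Yy0 y01] := cof_unit_vector Xinf Yc.
apply: (@supremum_supremums _ _ (`|x + t *: y0| - 1)); first by exists y0.
split=> [_ [y [Yy y1] <-]|b ubb].
  rewrite lerBlDl; apply: le_trans (ler_normD _ _) _.
  by rewrite x1 normrZ y1 mulr1 gtr0_norm.
have xb : `|x + t *: y0| - 1 <= b by apply: ubb; exists y0.
(* Realness makes [b] comparable with [t]; if [b < t], the error [t - b] yields a value above
   [b]. *)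
have b_real : b \is Num.real.
  rewrite -[b](subrK (`|x + t *: y0| - 1)) realD//.
  by rewrite ger0_real// subr_ge0.
rewrite real_leNgt ?(gtr0_real t0)//; apply/negP => bt.
have tb : 0 < t - b by rewrite subr_gt0.
have [y [Yy y1]] := super_AD_modulus Yc t01 tb.
rewrite (_ : 1 + t - (t - b) = 1 + b); last by ring.
move=> by1.
have : `|x + t *: y| - 1 <= b by apply: ubb; exists y.
by rewrite lerBlDl lt_geF.
Qed.

Lemma super_AD_rho (t : K) : 0 < t < 1 -> rho x t = t.
Proof.
move=> t01; rewrite /rho.
(* Every [Y] in [cof] gives the same supremum [t], and the whole space shows that there is such a
   [Y]. *)
rewrite (_ : [set _ | _ in @cof K X] = [set t]).
  rewrite /infimum; case: (eqVneq _ set0) => [/seteqP[/(_ t erefl)]//|_].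
  by rewrite infimums1; case: xgetP => [_ -> ->|/(_ t)/(_ erefl)].
apply/seteqP; split=> [_ [Y Yc <-]|_ ->]; first exact: super_AD_supremum.
by exists setT; [exact: cofT|apply: super_AD_supremum; first exact: cofT].
Qed.

Lemma super_AD_not_asymptotically_smooth : ~ asymptotically_smooth x.
Proof.
move=> /cvgrPdist_lt /(_ 1 ltr01) smooth.
have small : \forall t \near (0 : K)^'+, t < 1.
  have /nbhs_normP : exists2 r : K, 0 < r &
      forall s, `|0 - s| < r -> 0 < s -> s < 1.
    by exists 1 => // s; rewrite sub0r normrN => s1 s0; rewrite gtr0_norm in s1.
  by [].
have pos : \forall t \near (0 : K)^'+, 0 < t.
  by rewrite near_withinE; near=> t.
have [t [[t0 t1] st]] : exists t : K,
    (0 < t /\ t < 1) /\ `|0 - rho x t / t| < 1.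
  by near (0 : K)^'+ => t; exists t; split; [split|]; near: t.
move: st; rewrite super_AD_rho ?t0//= divff ?gt_eqF// sub0r normrN normr1.
by rewrite ltxx.
Unshelve. all: by end_near. Qed.

(** * Norming functionals and failure of Fréchet differentiability *)

Lemma norming_functional (z : X) : z != 0 ->
  exists g : {linear X -> K^o},
    [/\ dual_sphere g, forall y, `|g y| <= `|y| & g z = `|z|].
Proof.
move=> z0; have [g [gle gz]] :=
  seminorm_Hahn_Banach Kc Ki z (@ler_normD _ X) (@normrZ _ X).
exists g; split=> //; split; first exact: bounded_functional_continuous.
apply: (@supremum_supremums _ _ 0).
  by exists 0; [rewrite /unit_ball/= normr0 ler01|rewrite linear0 normr0].
split=> [_ [y y1 <-]|b]; first exact: le_trans (gle y) _.
apply; exists (`|z|^-1 *: z).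
  by rewrite /unit_ball/= normrZ normfV normr_id mulVf// normr_eq0.
by rewrite linearZ gz normrM normfV normr_id mulVf// normr_eq0.
Qed.

(** The bound [C] ensures that [dual_norm g] is a true supremum and not the default value. *)
Lemma le_dual_norm (g : X -> K) (C : K) (y : X) :
  (forall y, `|y| <= 1 -> `|g y| <= C) -> `|y| <= 1 -> `|g y| <= dual_norm g.
Proof.
move=> gC y1; rewrite /dual_norm; set E := (X in supremum _ X).
have Ey : E `|g y| by exists y.
have [|_ [z _ <-]||s sE] := @Kc E; first by exists `|g y|.
- exact: normr_real.
- by exists C => _ [z z1 <-]; exact: gC.
by rewrite (supremum_supremums Ey sE); exact: sE.1.
Qed.

Lemma super_AD_not_Frechet : ~ Frechet_differentiability_point x.
Proof.
move=> [f [fc f1] fP].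
have [v fv] : exists v, f v != 0.
  apply: contrapT => nv; move: f1; rewrite /dual_norm.
  rewrite (_ : [set _ | _ in _] = [set 0]) ?supremum1.
    by move/eqP; rewrite eq_sym oner_eq0.
  have f0 y : f y = 0 by apply/eqP/negPn/negP => fy; apply: nv; exists y.
  apply/seteqP; split=> [_ [y _ <-]|_ ->]; first by rewrite f0 normr0.
  by exists 0; [rewrite /unit_ball/= normr0 ler01|rewrite f0 normr0].
pose Y : set X := [set y | f y = 0].
have Yc : cof Y.
  split.
  - split; first exact: linear0.
    by move=> a y z; rewrite /Y/= linearP => -> ->; rewrite scaler0 addr0.
  - apply: (@closed_comp X K^o f [set 0]) => [y _|]; first exact: fc.
    by apply/accessible_closed_set1/hausdorff_accessible; exact: norm_hausdorff.
  (* The kernel has codimension one, and [v] spans the quotient. *)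
  - exists 1%N, (fun=> v) => z; exists (fun=> f z / f v).
    have fz : f ((f z / f v) *: v) = f z by rewrite linearZ; exact: divfK.
    by rewrite big_ord1 /Y/= linearB fz subrr.
(* The shift by 2 gives [t n < 1] already at [n = 0]. *)
pose t n : K := n.+2%:R^-1.
have t01 n : 0 < t n < 1.
  by rewrite invr_gt0 ltr0Sn/= invf_lt1 ?ltr0Sn// ltr1n.
have t2 n : 0 < t n / 2 by rewrite divr_gt0//; case/andP: (t01 n).
have xy n : exists y, [/\ f y = 0, `|y| = 1 & 1 + t n / 2 < `|x + t n *: y|].
  have [y [Yy y1] ty] := super_AD_modulus Yc (t01 n) (t2 n).
  exists y; split=> //; apply: le_lt_trans ty; rewrite -addrA lerD2l.
  by rewrite {2}[t n]splitr addrK.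
have zg n : exists g : {linear X -> K^o}, [/\ dual_sphere g,
    forall y, `|g y| <= `|y|, `|1 - g x| <= t n + t n &
    exists2 y, `|y| <= 1 & 2^-1 <= `|g y - f y|].
  have [y [fy y1 ty]] := xy n.
  have /andP[t0 t1] := t01 n.
  have xy1 : 1 < `|x + t n *: y|.
    by apply: lt_trans ty; rewrite ltrDl.
  have z0 : x + t n *: y != 0 by rewrite -normr_gt0 (lt_trans ltr01).
  have [g [gS gle gz]] := norming_functional z0.
  exists g; split=> //.
    (* Each summand has modulus at most [t n]. *)
    have -> : 1 - g x = (1 - `|x + t n *: y|) + t n * g y.
      by rewrite -gz linearD linearZ opprD addrA subrK.
    apply: le_trans (ler_normD _ _) _; apply: lerD.
      rewrite ler0_norm; last by rewrite subr_le0 ltW.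
      rewrite opprB lerBlDl.
      apply: le_trans (ler_normD _ _) _.
      by rewrite x1 normrZ y1 mulr1 gtr0_norm.
    by rewrite normrM gtr0_norm// ler_piMr ?(ltW t0)// -y1.
  exists y; first by rewrite y1.
  (* After multiplication by [t n] the claim becomes [1 + t n / 2 <= 1 + t n * |g y|], which follows
     from [g x + t n * g y = |x + t n *: y|] and [|g x| <= 1]. *)
  rewrite fy subr0 -(ler_pM2l t0) -[t n * `|_|](addKr 1) addrC lerBrDl.
  apply: (le_trans (ltW ty)); rewrite -[leLHS]gtr0_norm ?(lt_trans ltr01)//.
  rewrite -gz linearD linearZ; apply: le_trans (ler_normD _ _) _.
  by apply: lerD; [rewrite -x1|rewrite normrM gtr0_norm].
have [g gP] := choice zg.
have gS n : dual_sphere (g n) by case: (gP n).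
have gx : g n x @[n --> \oo] --> (1 : K^o).
  apply/cvgrPdist_lt => e e0.
  have e2 : 0 < e / 2 by rewrite divr_gt0.
  have [N Ne] := real_complete_archimedean Kc e2.
  exists N => // n /= Nn; have [_ _ gx _] := gP n.
  apply: (le_lt_trans gx); rewrite [e]splitr.
  suff tn : t n < e / 2 by rewrite ltrD.
  apply: le_lt_trans Ne; rewrite lef_pV2 ?posrE ?ltr0Sn// ler_nat.
  by rewrite ltnS leqW.
have /cvgrPdist_lt /(_ (2^-1)) := (fP g gS).1 gx.
rewrite invr_gt0 ltr0Sn => /(_ isT)[N _ /(_ N (leqnn N))] /=.
have [_ gle _ [y y1 gy]] := gP N.
(* As [dual_norm f = 1] is nonzero, it is a true supremum; this gives the bound [1 + 1] for
   [g N - f] on the ball. *)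
have fle z : `|z| <= 1 -> `|f z| <= 1.
  move=> z1; have : dual_norm f != 0 by rewrite f1 oner_neq0.
  by move=> /supremum_neq0[ubf _]; rewrite -f1; apply: ubf; exists z.
have gf : 2^-1 <= dual_norm (fun y => g N y - f y).
  apply: (le_trans gy); apply: (@le_dual_norm _ (1 + 1)) => // z z1.
  apply: le_trans (ler_normB _ _) _; apply: lerD; last exact: fle.
  exact: le_trans (gle z) z1.
rewrite sub0r normrN ger0_norm; last by apply: le_trans gf; rewrite invr_ge0.
by rewrite le_gtF.
Qed.

End Modulus.

Theorem proposition4p19 (R : realType) (K : numFieldType)
    (hK : K = (R : numFieldType) \/ K = (R[i] : numFieldType))
    (X : completeNormedModType K) (hX : infinite_dimensional X)
    (x : X) (hx : unit_sphere x) (hAD : super_AD_point x) :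
  [/\ forall t : K, 0 < t < 1 -> rho x t = t,
      ~ asymptotically_smooth x
    & ~ Frechet_differentiability_point x].
Proof.
have [Kc [i Ki]] : real_complete K /\ exists i : K, imaginary_unit i.
  case: hK => ->; split.
  - exact: real_complete_realType.
  - by exists 0; exact: imaginary_unit_realType.
  - exact: real_complete_complex.
  - by exists (Complex 0 1); exact: imaginary_unit_complex.
split.
- by move=> t t01; exact: (super_AD_rho Kc Ki hX hx hAD t01).
- exact (super_AD_not_asymptotically_smooth Kc Ki hX hx hAD).
- exact (super_AD_not_Frechet Kc Ki hX hx hAD).
Qed.
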